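(* Let $p,q\ge2$ be integers and let $M\in AD^+_{p,q}$ be a T-mesh which is dual-compatible with respect to the bi-order $(p,q)$. Then $M$ is weakly dual-compatible of each of the four types RD, RU, LD and LU.
   Context: **T-meshes.** Let $p,q\ge2$ be integers (orders), $\mu,\nu$ positive integers, and $\mathbf{\Sigma^s}=\{s_{-\lfloor p/2\rfloor+1}\le\dots\le s_{\mu+\lfloor p/2\rfloor}\}$, $\mathbf{\Sigma^t}=\{t_{-\lfloor q/2\rfloor+1}\le\dots\le t_{\nu+\lfloor q/2\rfloor}\}$ knot vectors in which each knot has multiplicity at most $p$, resp. $q$. An index T-mesh $M$ is a partition of the index domain $[-\lfloor p/2\rfloor+1,\mu+\lfloor p/2\rfloor]\times[-\lfloor q/2\rfloor+1,\nu+\lfloor q/2\rfloor]$ into (open) rectangles, called cells, whose vertices have integer coordinates (T-junctions are allowed, L- and I-junctions are not). $\mathcal V$ is the set of vertices; edges are the (open) horizontal or vertical segments of the mesh linking two consecutive vertices; $hE$, $vE$ are the sets of horizontal and vertical edges; $S$ is the union of all edges and vertices, $hS$ (resp. $vS$) the union of all horizontal (resp. vertical) edges and all vertices. The valence of a vertex is the number of edges having it as an endpoint. The active region is $AR_{p,q}=[1,\mu]\times[1,\nu]$; the frame region is $FR_{p,q}=\big([-\lfloor p/2\rfloor+1,1]\cup[\mu,\mu+\lfloor p/2\rfloor]\big)\times[-\lfloor q/2\rfloor+1,\nu+\lfloor q/2\rfloor]\ \cup\ [-\lfloor p/2\rfloor+1,\mu+\lfloor p/2\rfloor]\times\big([-\lfloor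 q/2\rfloor+1,1]\cup[\nu,\nu+\lfloor q/2\rfloor]\big)$. $M\in AD_{p,q}$ (admissible) if $S\cap FR_{p,q}$ contains the segments $\{l\}\times[-\lfloor q/2\rfloor+1,\nu+\lfloor q/2\rfloor]$ for $l=-\lfloor p/2\rfloor+1,\dots,1$ and $l=\mu,\dots,\mu+\lfloor p/2\rfloor$, and $[-\lfloor p/2\rfloor+1,\mu+\lfloor p/2\rfloor]\times\{l\}$ for $l=-\lfloor q/2\rfloor+1,\dots,1$ and $l=\nu,\dots,\nu+\lfloor q/2\rfloor$, and all vertices in $(-\lfloor p/2\rfloor+1,\mu+\lfloor p/2\rfloor)\times(-\lfloor q/2\rfloor+1,\nu+\lfloor q/2\rfloor)\cap FR_{p,q}$ have valence 4. $M\in AD_{p,q}$ belongs to $AD^+_{p,q}$ if for any two vertices $(i_1,j_1),(i_2,j_2)$ both on the boundary of one cell with $i_1=i_2$ (resp. $j_1=j_2$), the segment $\{i_1\}\times(j_1,j_2)$ (resp. $(i_1,i_2)\times\{j_1\}$) is contained in $S$. **Anchors and index vectors.** $\mathcal{A}_{p,q}(M)$ is the set of all $A\subset AR_{p,q}$ that are: vertices if $p,q$ are even; horizontal edges if $p$ is odd and $q$ even; vertical edges if $p$ is even and $q$ odd; cells if $p,q$ are odd. Write $A=a\times b$ with each of $a,b$ a singleton or an open interval. The global horizontal index vector is $\mathbf{I^s}(A)=\{i\in\mathbb Z:\{i\}\times b\subset vS\}$ and the global vertical one is $\mathbf{I^t}(A)=\{j\in\mathbb Z: a\times\{j\}\subset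 hS\}$, in increasing order. The local horizontal index vector $\mathbf{I^s_l}(A)=\{i^s_1(A)<\dots<i^s_{p+1}(A)\}$ consists of $p+1$ consecutive elements of $\mathbf{I^s}(A)$ with $a=\{i^s_{p/2+1}(A)\}$ if $p$ is even and $a=(i^s_{(p+1)/2}(A),i^s_{(p+1)/2+1}(A))$ if $p$ is odd; $\mathbf{I^t_l}(A)=\{i^t_1(A)<\dots<i^t_{q+1}(A)\}$ is defined analogously from $\mathbf{I^t}(A)$ and $b$. For an index vector $\mathbf{I^s}$, $\mathbf{\Sigma^s}(\mathbf{I^s})=\{s_i:i\in\mathbf{I^s}\}$ (with repetitions), similarly $\mathbf{\Sigma^t}(\mathbf{I^t})$. **Dual-compatibility.** Anchors $A_1,A_2$ overlap horizontally if every $k\in\mathbf{I^s_l}(A_1)$ with $i^s_1(A_2)\le k\le i^s_{p+1}(A_2)$ belongs to $\mathbf{I^s_l}(A_2)$, and every $k\in\mathbf{I^s_l}(A_2)$ with $i^s_1(A_1)\le k\le i^s_{p+1}(A_1)$ belongs to $\mathbf{I^s_l}(A_1)$. They overlap vertically if every $h\in\mathbf{I^t_l}(A_1)$ with $i^t_1(A_2)\le h\le i^t_{q+1}(A_2)$ belongs to $\mathbf{I^t_l}(A_2)$, and every $h\in\mathbf{I^t_l}(A_2)$ with $i^t_1(A_1)\le h\le i^t_{q+1}(A_1)$ belongs to $\mathbf{I^t_l}(A_1)$. They partially overlap if they overlap horizontally or vertically. $M\in AD^+_{p,q}$ is dual-compatible with respect to $(p,q)$ if any two anchors in $\mathcal{A}_{p,q}(M)$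 partially overlap. **Weak dual-compatibility.** Two anchors $A_1,A_2$ are left-horizontally shifted if $|\min\mathbf{I^s_l}(A_1)-\min\mathbf{I^s_l}(A_2)|>0$ and, if $\min\mathbf{\Sigma^s}(\mathbf{I^s_l}(A_1))=\min\mathbf{\Sigma^s}(\mathbf{I^s_l}(A_2))$, the respective multiplicities of these minimal knots in $\mathbf{\Sigma^s}(\mathbf{I^s_l}(A_1))$ and $\mathbf{\Sigma^s}(\mathbf{I^s_l}(A_2))$ are different. They are right-horizontally shifted if the same holds with $\max$ in place of $\min$. They are down-vertically (resp. up-vertically) shifted if the condition with $\min$ (resp. $\max$) holds for $\mathbf{I^t_l}$, $\mathbf{\Sigma^t}$ in place of $\mathbf{I^s_l}$, $\mathbf{\Sigma^s}$. The T-mesh is weakly dual-compatible of type RD if any two distinct anchors are right-horizontally or down-vertically shifted; of type RU if any two distinct anchors are right-horizontally or up-vertically shifted; of type LD if any two distinct anchors are left-horizontally or down-vertically shifted; of type LU if any two distinct anchors are left-horizontally or up-vertically shifted (''or'' inclusive). *)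

(* Defs.v *)
From mathcomp Require Import all_boot all_order all_algebra.
From mathcomp Require Import mathcomp_extra boolp classical_sets functions.
From mathcomp Require Import cardinality set_interval reals.

Set Implicit Arguments.
Unset Strict Implicit.
Unset Printing Implicit Defensive.

Import Order.TTheory GRing.Theory Num.Theory.
Local Open Scope classical_set_scope.
Local Open Scope ring_scope.

(* One factor of a mesh element: [Pt i] is the singleton {i} and [Itv i j] the
   open interval ]i, j[.  Vertices, edges, cells and anchors are all products
   of two factors, the first one horizontal and the second one vertical. *)
Inductive factor := Pt of int | Itv of int & int.

Definition box : Type := (factor * factor)%type.

Definition factor_set (R : realType) (a : factor) : set R :=
  match a with
  | Pt i => [set i%:~R]
  | Itv i j => `]i%:~R, j%:~R[
  end.
Arguments factor_set R a : clear implicits.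

Definition closed_factor_set (R : realType) (a : factor) : set R :=
  match a with
  | Pt i => [set i%:~R]
  | Itv i j => `[i%:~R, j%:~R]
  end.
Arguments closed_factor_set R a : clear implicits.

Definition box_set (R : realType) (A : box) : set (R * R) :=
  factor_set R A.1 `*` factor_set R A.2.
Arguments box_set R A : clear implicits.

Definition closed_box_set (R : realType) (A : box) : set (R * R) :=
  closed_factor_set R A.1 `*` closed_factor_set R A.2.
Arguments closed_box_set R A : clear implicits.

Definition boundary (R : realType) (A : box) : set (R * R) :=
  closed_box_set R A `\` box_set R A.
Arguments boundary R A : clear implicits.

(* First and last index in a direction of order [p] with parameter [mu]. *)
Definition ilo (p : nat) : int := 1 - (p./2)%:Z.
Definition ihi (p mu : nat) : int := mu%:Z + (p./2)%:Z.

Definition domain_itv (R : realType) (p mu : nat) : set R :=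
  `[(ilo p)%:~R, (ihi p mu)%:~R].
Arguments domain_itv R p mu : clear implicits.

Definition index_domain (R : realType) (p q mu nu : nat) : set (R * R) :=
  domain_itv R p mu `*` domain_itv R q nu.
Arguments index_domain R p q mu nu : clear implicits.

Definition open_index_domain (R : realType) (p q mu nu : nat) : set (R * R) :=
  `](ilo p)%:~R, (ihi p mu)%:~R[ `*` `](ilo q)%:~R, (ihi q nu)%:~R[.
Arguments open_index_domain R p q mu nu : clear implicits.

Definition active_region (R : realType) (mu nu : nat) : set (R * R) :=
  `[1, mu%:R] `*` `[1, nu%:R].
Arguments active_region R mu nu : clear implicits.

Definition frame_itv (R : realType) (p mu : nat) : set R :=
  `[(ilo p)%:~R, 1] `|` `[mu%:R, (ihi p mu)%:~R].
Arguments frame_itv R p mu : clear implicits.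

Definition frame_region (R : realType) (p q mu nu : nat) : set (R * R) :=
  (frame_itv R p mu `*` domain_itv R q nu) `|`
  (domain_itv R p mu `*` frame_itv R q nu).
Arguments frame_region R p q mu nu : clear implicits.

Definition is_rectangle (A : box) : Prop :=
  exists i1 i2 j1 j2 : int,
    [/\ A = (Itv i1 i2, Itv j1 j2), i1 < i2 & j1 < j2].

(* Cells are open, so the index domain is the union of their closures. *)
Record tmesh (R : realType) (p q mu nu : nat) := TMesh {
  cells : set box;
  cells_rectangle : forall C, cells C -> is_rectangle C;
  cells_disjoint : forall C D, cells C -> cells D -> C <> D ->
    box_set R C `&` box_set R D = set0;
  cells_cover :
    \bigcup_(C in cells) closed_box_set R C = index_domain R p q mu nu
}.

(* The vertices are exactly the corners of the cells.  This rules out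
   I-junctions, and a partition into rectangles has no L-junction inside the
   index domain. *)
Definition is_vertex (R : realType) (p q mu nu : nat)
    (M : tmesh R p q mu nu) (i j : int) : Prop :=
  exists i1 i2 j1 j2 : int,
    [/\ cells M (Itv i1 i2, Itv j1 j2), i = i1 \/ i = i2 & j = j1 \/ j = j2].

Definition cell_boundaries (R : realType) (p q mu nu : nat)
    (M : tmesh R p q mu nu) : set (R * R) :=
  \bigcup_(C in cells M) boundary R C.

Definition vertices (R : realType) (p q mu nu : nat)
    (M : tmesh R p q mu nu) : set box :=
  [set A | exists i j : int, A = (Pt i, Pt j) /\ is_vertex M i j].

Definition hedges (R : realType) (p q mu nu : nat)
    (M : tmesh R p q mu nu) : set box :=
  [set A | exists i1 i2 j : int,
    A = (Itv i1 i2, Pt j) /\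
    [/\ i1 < i2, is_vertex M i1 j, is_vertex M i2 j,
        forall k : int, i1 < k < i2 -> ~ is_vertex M k j
      & box_set R A `<=` cell_boundaries M]].

Definition vedges (R : realType) (p q mu nu : nat)
    (M : tmesh R p q mu nu) : set box :=
  [set A | exists i j1 j2 : int,
    A = (Pt i, Itv j1 j2) /\
    [/\ j1 < j2, is_vertex M i j1, is_vertex M i j2,
        forall k : int, j1 < k < j2 -> ~ is_vertex M i k
      & box_set R A `<=` cell_boundaries M]].

Definition hS (R : realType) (p q mu nu : nat)
    (M : tmesh R p q mu nu) : set (R * R) :=
  \bigcup_(A in hedges M `|` vertices M) box_set R A.

Definition vS (R : realType) (p q mu nu : nat)
    (M : tmesh R p q mu nu) : set (R * R) :=
  \bigcup_(A in vedges M `|` vertices M) box_set R A.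

Definition skeleton (R : realType) (p q mu nu : nat)
    (M : tmesh R p q mu nu) : set (R * R) :=
  \bigcup_(A in hedges M `|` vedges M `|` vertices M) box_set R A.

Definition has_endpoint (A : box) (i j : int) : Prop :=
  match A with
  | (Itv i1 i2, Pt j') => j = j' /\ (i = i1 \/ i = i2)
  | (Pt i', Itv j1 j2) => i = i' /\ (j = j1 \/ j = j2)
  | _ => False
  end.

Definition has_valence (R : realType) (p q mu nu : nat)
    (M : tmesh R p q mu nu) (i j : int) (n : nat) : Prop :=
  ([set A | (hedges M `|` vedges M) A /\ has_endpoint A i j] #= `I_n)%card.

Definition in_frame_index (p mu : nat) (l : int) : bool :=
  (ilo p <= l <= 1) || (mu%:Z <= l <= ihi p mu).

Definition admissible (R : realType) (p q mu nu : nat)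
    (M : tmesh R p q mu nu) : Prop :=
  [/\ forall l : int, in_frame_index p mu l ->
        [set l%:~R] `*` domain_itv R q nu
          `<=` skeleton M `&` frame_region R p q mu nu,
      forall l : int, in_frame_index q nu l ->
        domain_itv R p mu `*` [set l%:~R]
          `<=` skeleton M `&` frame_region R p q mu nu
    & forall i j : int, is_vertex M i j ->
        (open_index_domain R p q mu nu `&` frame_region R p q mu nu)
          (i%:~R, j%:~R) ->
        has_valence M i j 4].

(* Both orders of the two vertices are covered, the open interval ]k1, k2[
   being empty when k2 <= k1. *)
Definition admissible_plus (R : realType) (p q mu nu : nat)
    (M : tmesh R p q mu nu) : Prop :=
  [/\ admissible M,
      forall (C : box) (i j1 j2 : int), cells M C ->
        is_vertex M i j1 -> is_vertex M i j2 ->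
        boundary R C (i%:~R, j1%:~R) -> boundary R C (i%:~R, j2%:~R) ->
        box_set R (Pt i, Itv j1 j2) `<=` skeleton M
    & forall (C : box) (i1 i2 j : int), cells M C ->
        is_vertex M i1 j -> is_vertex M i2 j ->
        boundary R C (i1%:~R, j%:~R) -> boundary R C (i2%:~R, j%:~R) ->
        box_set R (Itv i1 i2, Pt j) `<=` skeleton M].

Definition anchors (R : realType) (p q mu nu : nat)
    (M : tmesh R p q mu nu) : set box :=
  [set A | box_set R A `<=` active_region R mu nu /\
    match odd p, odd q with
    | false, false => vertices M A
    | true, false => hedges M A
    | false, true => vedges M A
    | true, true => cells M A
    end].

Definition global_hindex (R : realType) (p q mu nu : nat)
    (M : tmesh R p q mu nu) (A : box) : set int :=
  [set i | [set i%:~R] `*` factor_set R A.2 `<=` vS M].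

Definition global_vindex (R : realType) (p q mu nu : nat)
    (M : tmesh R p q mu nu) (A : box) : set int :=
  [set j | factor_set R A.1 `*` [set j%:~R] `<=` hS M].

(* [v] lists [p + 1] consecutive elements of [I] in increasing order, with [a]
   in the middle.  The paper's i_k is [v`_(k.-1)], whence the position [p./2]
   for both i_(p/2+1) (p even) and i_((p+1)/2) (p odd). *)
Definition is_local_index (p : nat) (I : set int) (a : factor)
    (v : seq int) : Prop :=
  [/\ size v = p.+1,
      sorted <%R v,
      forall k : int, v`_0 <= k <= v`_p -> (k \in v <-> I k)
    & a = if odd p then Itv v`_(p./2) v`_(p./2).+1 else Pt v`_(p./2)].

(* There is at most one such list, and one exists for every anchor of an
   admissible mesh; the default value [::] is not meaningful. *)
Definition local_index (p : nat) (I : set int) (a : factor) : seq int :=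
  xget [::] [set v | is_local_index p I a v].

Definition local_hindex (R : realType) (p q mu nu : nat)
    (M : tmesh R p q mu nu) (A : box) : seq int :=
  local_index p (global_hindex M A) A.1.

Definition local_vindex (R : realType) (p q mu nu : nat)
    (M : tmesh R p q mu nu) (A : box) : seq int :=
  local_index q (global_vindex M A) A.2.

Definition index_overlap (p : nat) (v1 v2 : seq int) : Prop :=
  (forall k : int, k \in v1 -> v2`_0 <= k <= v2`_p -> k \in v2) /\
  (forall k : int, k \in v2 -> v1`_0 <= k <= v1`_p -> k \in v1).

Definition overlap_horizontally (R : realType) (p q mu nu : nat)
    (M : tmesh R p q mu nu) (A1 A2 : box) : Prop :=
  index_overlap p (local_hindex M A1) (local_hindex M A2).

Definition overlap_vertically (R : realType) (p q mu nu : nat)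
    (M : tmesh R p q mu nu) (A1 A2 : box) : Prop :=
  index_overlap q (local_vindex M A1) (local_vindex M A2).

Definition partially_overlap (R : realType) (p q mu nu : nat)
    (M : tmesh R p q mu nu) (A1 A2 : box) : Prop :=
  overlap_horizontally M A1 A2 \/ overlap_vertically M A1 A2.

Definition dual_compatible (R : realType) (p q mu nu : nat)
    (M : tmesh R p q mu nu) : Prop :=
  forall A1 A2 : box, anchors M A1 -> anchors M A2 -> partially_overlap M A1 A2.

(* The integers ilo p, ..., ihi p mu in increasing order. *)
Definition knot_indices (p mu : nat) : seq int :=
  [seq ilo p + k%:Z | k <- iota 0 (mu + (p./2).*2)].

(* Only the values of [s] at [knot_indices p mu] matter. *)
Definition knot_vector (R : realType) (p mu : nat) (s : int -> R) : Prop :=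
  (forall i j : int, i \in knot_indices p mu -> j \in knot_indices p mu ->
     i <= j -> s i <= s j) /\
  (forall x : R, (count_mem x (map s (knot_indices p mu)) <= p)%N).

Definition seq_min (T : realDomainType) (v : seq T) : T :=
  \big[Num.min/head 0 v]_(x <- v) x.

Definition seq_max (T : realDomainType) (v : seq T) : T :=
  \big[Num.max/head 0 v]_(x <- v) x.

Definition min_shifted (R : realType) (s : int -> R) (v1 v2 : seq int) : Prop :=
  let w1 := map s v1 in
  let w2 := map s v2 in
  `|seq_min v1 - seq_min v2| > 0 /\
  (seq_min w1 = seq_min w2 ->
   count_mem (seq_min w1) w1 <> count_mem (seq_min w2) w2).

Definition max_shifted (R : realType) (s : int -> R) (v1 v2 : seq int) : Prop :=
  let w1 := map s v1 in
  let w2 := map s v2 in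
  `|seq_max v1 - seq_max v2| > 0 /\
  (seq_max w1 = seq_max w2 ->
   count_mem (seq_max w1) w1 <> count_mem (seq_max w2) w2).

Definition left_shifted (R : realType) (p q mu nu : nat)
    (M : tmesh R p q mu nu) (s : int -> R) (A1 A2 : box) : Prop :=
  min_shifted s (local_hindex M A1) (local_hindex M A2).

Definition right_shifted (R : realType) (p q mu nu : nat)
    (M : tmesh R p q mu nu) (s : int -> R) (A1 A2 : box) : Prop :=
  max_shifted s (local_hindex M A1) (local_hindex M A2).

Definition down_shifted (R : realType) (p q mu nu : nat)
    (M : tmesh R p q mu nu) (t : int -> R) (A1 A2 : box) : Prop :=
  min_shifted t (local_vindex M A1) (local_vindex M A2).

Definition up_shifted (R : realType) (p q mu nu : nat)
    (M : tmesh R p q mu nu) (t : int -> R) (A1 A2 : box) : Prop :=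
  max_shifted t (local_vindex M A1) (local_vindex M A2).

Definition weakly_dual_compatible_RD (R : realType) (p q mu nu : nat)
    (M : tmesh R p q mu nu) (s t : int -> R) : Prop :=
  forall A1 A2 : box, anchors M A1 -> anchors M A2 -> A1 <> A2 ->
    right_shifted M s A1 A2 \/ down_shifted M t A1 A2.

Definition weakly_dual_compatible_RU (R : realType) (p q mu nu : nat)
    (M : tmesh R p q mu nu) (s t : int -> R) : Prop :=
  forall A1 A2 : box, anchors M A1 -> anchors M A2 -> A1 <> A2 ->
    right_shifted M s A1 A2 \/ up_shifted M t A1 A2.

Definition weakly_dual_compatible_LD (R : realType) (p q mu nu : nat)
    (M : tmesh R p q mu nu) (s t : int -> R) : Prop :=
  forall A1 A2 : box, anchors M A1 -> anchors M A2 -> A1 <> A2 ->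
    left_shifted M s A1 A2 \/ down_shifted M t A1 A2.

Definition weakly_dual_compatible_LU (R : realType) (p q mu nu : nat)
    (M : tmesh R p q mu nu) (s t : int -> R) : Prop :=
  forall A1 A2 : box, anchors M A1 -> anchors M A2 -> A1 <> A2 ->
    left_shifted M s A1 A2 \/ up_shifted M t A1 A2.

(* Main.v *)
From mathcomp Require Import all_boot all_order all_algebra.
From mathcomp Require Import boolp classical_sets set_interval reals.
From mathcomp Require Import zify lra.
Require Import Defs.

(** The proof shows more than each of the four types separately: two distinct
anchors are shifted on both sides (left and right) horizontally, or on both
sides (down and up) vertically.

Everything rests on one fact about index vectors, [overlap_shifted].  Let [v1]
and [v2] be distinct, strictly increasing, of the same length [p + 1], and let
each contain the elements of the other that lie in its own range.  Neither
range contains the other, since an inclusion of ranges gives an inclusion of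
vectors of equal length, that is, equality.  So one of them, say [v1], starts
and ends strictly before the other.  If the two minimal knots agree, every
element of [v2] that carries this knot lies before the end of [v1], because
multiplicities are at most [p] and so [v1] must leave the knot; hence it
belongs to [v1], and the multiplicity in [v1] is larger at least by one, that
of the first element of [v1].  The maximal knots are symmetric.

It remains to find a direction in which two distinct anchors overlap and have
different vectors.  The factor of an anchor is the middle of its vector, so
anchors with different horizontal factors have different horizontal vectors,
and the same vertically.  If both factors differ, dual-compatibility gives the
direction.  If the horizontal factors agree, so do the global vertical index
vectors, which depend on that factor only; the two local vertical vectors are
then made of consecutive elements of the same set, hence overlap
([same_index_overlap]), and differ because the vertical factors do.  The other
case is symmetric.

For this the local index vectors must exist and stay in the index domain
([local_index_exists], [local_index_subset]).  Existence needs two properties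
of a mesh with vertical frame lines ([anchor_hcentered]): the frame lines
belong to the global index vector of every anchor, which supplies enough
indices on each side; and the end points of an edge or a cell are consecutive
there.  For the frame lines, and for the end points of an edge, this rests on
[crossing_is_vertex]: where a horizontal and a vertical segment of cell
boundaries cross at an integer point, this point is the corner of a cell.  For
the end points of a cell, it rests on the fact that open cells do not meet cell
boundaries, and on a description of the sides of a cell by edges and vertices
([cell_side_vS]).  The vertical statements follow by transposing the mesh. *)

Set Implicit Arguments.
Unset Strict Implicit.
Unset Printing Implicit Defensive.

Import Order.TTheory GRing.Theory Num.Theory.
Local Open Scope classical_set_scope.
Local Open Scope ring_scope.

(** * Overlapping index vectors and the multiplicity of extreme knots *)

Lemma seq_min_eq (T : realDomainType) (v : seq T) (x : T) :
  x \in v -> (forall y, y \in v -> x <= y) -> seq_min v = x.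
Proof.
move=> xv lex; apply/le_anti/andP; split; first exact: ge_bigmin_seq.
rewrite /seq_min big_seq; elim/big_ind: _ => //.
- by case: v xv lex => // y v _; apply; rewrite inE eqxx.
- by move=> y z xy xz; rewrite le_min xy.
Qed.

Lemma seq_max_eq (T : realDomainType) (v : seq T) (x : T) :
  x \in v -> (forall y, y \in v -> y <= x) -> seq_max v = x.
Proof.
move=> xv lex; apply/le_anti/andP; split; last exact: le_bigmax_seq.
rewrite /seq_max big_seq; elim/big_ind: _ => //.
- by case: v xv lex => // y v _; apply; rewrite inE eqxx.
- by move=> y z xy xz; rewrite ge_max xy.
Qed.

Lemma sorted_mem_bounds (v : seq int) (p : nat) (k : int) :
  sorted <%R v -> size v = p.+1 -> k \in v -> v`_0 <= k <= v`_p.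
Proof.
move=> sv zv /(nthP 0)[i]; rewrite zv => ilt <-.
by rewrite !(lt_sorted_leq_nth 0 sv) ?inE ?zv // -ltnS ilt.
Qed.

Lemma count_lt_extra (T : eqType) (P : pred T) (u v : seq T) (z : T) :
  uniq u -> z \in v -> P z -> z \notin u ->
  (forall k, k \in u -> P k -> k \in v) -> (count P u < count P v)%N.
Proof.
move=> uu zv Pz zu sub; rewrite -!size_filter.
apply: (@uniq_leq_size _ (z :: filter P u)) => [|k].
  by rewrite /= filter_uniq // mem_filter (negPf zu) andbF.
rewrite inE mem_filter => /orP[/eqP->|/andP[Pk ku]]; first by rewrite mem_filter Pz.
by rewrite mem_filter Pk sub.
Qed.

(** A multiplicity of at most [p] forbids [p + 1] indices on one knot. *)
Lemma knot_vector_lt (R : realType) (p mu : nat) (s : int -> R) (v : seq int) :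
  knot_vector p mu s -> sorted <%R v -> size v = p.+1 ->
  {subset v <= knot_indices p mu} -> s v`_0 < s v`_p.
Proof.
move=> [smon smul] sv zv sub.
have mv i : (i <= p)%N -> v`_i \in v by move=> ip; rewrite mem_nth // zv ltnS.
rewrite lt_neqAle smon ?sub ?mv // ?andbT; last first.
  by have /andP[] := sorted_mem_bounds sv zv (mv p (leqnn p)).
apply/eqP => e; have := smul (s v`_0).
rewrite leqNgt => /negP; apply.
rewrite count_map -zv -size_filter uniq_leq_size ?lt_sorted_uniq // => k kv.
rewrite mem_filter sub //= andbT eq_le.
have /andP[v0k kvp] := sorted_mem_bounds sv zv kv.
by rewrite {1}e !smon ?sub ?mv.
Qed.

Lemma sorted_extrema (R : realType) (p mu : nat) (s : int -> R) (v : seq int) :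
  knot_vector p mu s -> sorted <%R v -> size v = p.+1 ->
  {subset v <= knot_indices p mu} ->
  [/\ seq_min v = v`_0, seq_max v = v`_p,
      seq_min (map s v) = s v`_0 & seq_max (map s v) = s v`_p].
Proof.
move=> [smon _] sv zv sub; have b := sorted_mem_bounds sv zv.
have mv i : (i <= p)%N -> v`_i \in v by move=> ip; rewrite mem_nth // zv ltnS.
split.
- by apply: seq_min_eq => [|k /b /andP[]//]; apply: mv.
- by apply: seq_max_eq => [|k /b /andP[]//]; apply: mv.
- apply: seq_min_eq => [|_ /mapP[k kv ->]]; first exact/map_f/mv.
  by apply: smon; rewrite ?sub ?mv //; case/andP: (b k kv).
- apply: seq_max_eq => [|_ /mapP[k kv ->]]; first exact/map_f/mv.
  by apply: smon; rewrite ?sub ?mv //; case/andP: (b k kv).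
Qed.

(** Overlap turns an inclusion of ranges into an inclusion of vectors, and
the vectors have the same length. *)
Lemma overlap_nested_eq (p : nat) (v1 v2 : seq int) :
  sorted <%R v1 -> size v1 = p.+1 -> sorted <%R v2 -> size v2 = p.+1 ->
  index_overlap p v1 v2 -> v2`_0 <= v1`_0 -> v1`_p <= v2`_p -> v1 = v2.
Proof.
move=> sv1 zv1 sv2 zv2 [o12 _] le0 lep; apply: lt_sorted_eq => //.
have sub : {subset v1 <= v2}.
  move=> k kv1; have /andP[k0 kp] := sorted_mem_bounds sv1 zv1 kv1.
  by apply: o12; rewrite // (le_trans le0 k0) (le_trans kp lep).
by have [] := uniq_min_size (lt_sorted_uniq sv1) sub; rewrite ?zv1 ?zv2.
Qed.

(** Each claim is a strict comparison of multiplicities.  At the minimal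
knot, [v2] contributes only indices that already belong to [v1], while the
first index of [v1] is missing from [v2]; at the maximal knot the roles of
[v1] and [v2] are exchanged. *)
Lemma overlap_before_shifted (R : realType) (p mu : nat) (s : int -> R)
    (v1 v2 : seq int) :
  knot_vector p mu s ->
  sorted <%R v1 -> size v1 = p.+1 -> {subset v1 <= knot_indices p mu} ->
  sorted <%R v2 -> size v2 = p.+1 -> {subset v2 <= knot_indices p mu} ->
  index_overlap p v1 v2 -> v1`_0 < v2`_0 -> v1`_p < v2`_p ->
  min_shifted s v1 v2 /\ max_shifted s v1 v2.
Proof.
move=> ks sv1 zv1 k1 sv2 zv2 k2 [o12 o21] lt0 ltp.
have [smon _] := ks.
have b1 := sorted_mem_bounds sv1 zv1; have b2 := sorted_mem_bounds sv2 zv2.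
have m1 i : (i <= p)%N -> v1`_i \in v1 by move=> ip; rewrite mem_nth // zv1 ltnS.
have m2 i : (i <= p)%N -> v2`_i \in v2 by move=> ip; rewrite mem_nth // zv2 ltnS.
rewrite /min_shifted /max_shifted.
have [-> -> -> ->] := sorted_extrema ks sv1 zv1 k1.
have [-> -> -> ->] := sorted_extrema ks sv2 zv2 k2.
rewrite !normr_gt0 !subr_eq0 (lt_eqF lt0) (lt_eqF ltp); split; split=> // e.
- rewrite -e !count_map; apply/nesym/eqP; rewrite ltn_eqF //.
  apply: (@count_lt_extra _ _ _ _ v1`_0) => [||||k kv2 /= /eqP sk].
  + by apply: lt_sorted_uniq.
  + exact: m1.
  + by rewrite /= eqxx.
  + by apply/negP => /b2; rewrite leNgt lt0.
  (* An index of [v2] beyond the range of [v1] would force all of [v1] onto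
     the minimal knot. *)
  + have /andP[k0 _] := b2 _ kv2.
    apply: o21 => //; rewrite (le_trans (ltW lt0) k0) /= leNgt; apply/negP => kp.
    have := knot_vector_lt ks sv1 zv1 k1.
    by rewrite ltNge -sk smon ?(ltW kp) ?(k2 k kv2) ?k1 ?m1.
- rewrite e !count_map; apply/eqP; rewrite ltn_eqF //.
  apply: (@count_lt_extra _ _ _ _ v2`_p) => [||||k kv1 /= /eqP sk].
  + by apply: lt_sorted_uniq.
  + exact: m2.
  + by rewrite /= eqxx.
  + by apply/negP => /b1; rewrite andbC leNgt ltp.
  + have /andP[_ kp] := b1 _ kv1.
    apply: o12 => //; rewrite (le_trans kp (ltW ltp)) andbT leNgt; apply/negP => k0.
    have := knot_vector_lt ks sv2 zv2 k2.
    by rewrite ltNge -sk smon ?(ltW k0) ?(k1 k kv1) ?k2 ?m2.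
Qed.

Lemma min_shifted_sym (R : realType) (s : int -> R) (v1 v2 : seq int) :
  min_shifted s v1 v2 -> min_shifted s v2 v1.
Proof. by rewrite /min_shifted distrC => -[-> ne]; split=> // /esym/ne/nesym. Qed.

Lemma max_shifted_sym (R : realType) (s : int -> R) (v1 v2 : seq int) :
  max_shifted s v1 v2 -> max_shifted s v2 v1.
Proof. by rewrite /max_shifted distrC => -[-> ne]; split=> // /esym/ne/nesym. Qed.

Lemma overlap_shifted (R : realType) (p mu : nat) (s : int -> R)
    (v1 v2 : seq int) :
  knot_vector p mu s ->
  sorted <%R v1 -> size v1 = p.+1 -> {subset v1 <= knot_indices p mu} ->
  sorted <%R v2 -> size v2 = p.+1 -> {subset v2 <= knot_indices p mu} ->
  index_overlap p v1 v2 -> v1 <> v2 ->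
  min_shifted s v1 v2 /\ max_shifted s v1 v2.
Proof.
move=> ks sv1 zv1 k1 sv2 zv2 k2 o ne.
have o' : index_overlap p v2 v1 by case: o.
have nest12 := overlap_nested_eq sv1 zv1 sv2 zv2 o.
have nest21 := overlap_nested_eq sv2 zv2 sv1 zv1 o'.
case: (ltgtP v1`_0 v2`_0) => [lt0|gt0|e0]; case: (ltgtP v1`_p v2`_p) => [ltp|gtp|ep].
- exact: (overlap_before_shifted ks sv1 zv1 k1 sv2 zv2 k2 o lt0 ltp).
- by case: ne; rewrite nest21 ?ltW.
- by case: ne; rewrite nest21 ?(ltW lt0) ?ep.
- by case: ne; rewrite nest12 ?ltW.
- have [mn mx] := overlap_before_shifted ks sv2 zv2 k2 sv1 zv1 k1 o' gt0 gtp.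
  by split; [apply: min_shifted_sym|apply: max_shifted_sym].
- by case: ne; rewrite nest12 ?(ltW gt0) ?ep.
- by case: ne; rewrite nest12 ?(ltW ltp) ?e0.
- by case: ne; rewrite nest21 ?(ltW gtp) ?e0.
- by case: ne; rewrite nest12 ?e0 ?ep.
Qed.

(** * Existence and range of local index vectors *)

(** [is_local_index] freed from its length and its prescribed middle, so that
a local index vector can be built by adding one element at a time. *)
Definition window (I : set int) (v : seq int) : Prop :=
  sorted <%R v /\ forall k : int, v`_0 <= k <= last 0 v -> (k \in v <-> I k).

Lemma ex_greatest_below (I : set int) (x y : int) : I y -> y < x ->
  exists z : int, [/\ y <= z < x, I z & forall k : int, z < k < x -> ~ I k].
Proof.
move=> Iy yx.
have down (k : int) : k < x -> k = x - 1 - (absz (x - 1 - k)%R)%:Z by lia.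
have ex : exists n : nat, `[< I (x - 1 - n%:Z) >].
  by exists (absz (x - 1 - y)%R); apply/asboolP; rewrite -down.
case: (ex_minnP ex) => n /asboolP In nmin; exists (x - 1 - n%:Z).
have le_n (k : int) : k < x -> I k -> k <= x - 1 - n%:Z.
  move=> kx Ik; suff /nmin : `[< I (x - 1 - (absz (x - 1 - k)%R)%:Z) >] by lia.
  by apply/asboolP; rewrite -down.
split=> // [|k /andP[zk kx] /(le_n k kx)]; last by rewrite leNgt zk.
by rewrite le_n //=; lia.
Qed.

Lemma ex_least_above (I : set int) (x y : int) : I y -> x < y ->
  exists z : int, [/\ x < z <= y, I z & forall k : int, x < k < z -> ~ I k].
Proof.
move=> Iy xy.
have INy : I (- - y) by rewrite opprK.
have [|z [/andP[yz zx] Iz nI]] := @ex_greatest_below [set k | I (- k)] (- x) _ INy.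
  by rewrite ltrN2.
exists (- z); split=> // [|k /andP[xk kz]]; first by apply/andP; lia.
have -> : k = - - k by rewrite opprK.
by apply: nI; rewrite ltrN2 xk andbT; lia.
Qed.

(** The new element is not the given [y] but the greatest element of [I]
before the run, so that no element of [I] is skipped; only the bound [y <= z]
is kept, to control where a run ends after several extensions. *)
Lemma window_cons (I : set int) (v : seq int) (y : int) :
  window I v -> v <> [::] -> I y -> y < v`_0 ->
  exists2 z : int, y <= z & window I (z :: v).
Proof.
case: v => // x w [sw mw] _ Iy /(ex_greatest_below Iy)[z [/andP[yz zx] Iz nI]].
exists z => //; split=> [|k /= /andP[zk kl]]; first by rewrite /= zx.
rewrite inE; have [->|kz] := eqVneq k z; first by [].
have zltk : z < k by rewrite lt_neqAle eq_sym kz.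
have [xk|kx] := leP x k; first by apply: mw; rewrite /= xk.
split=> [kv|]; last by move=> /nI[]; rewrite zltk.
have [xk' _] := andP (sorted_mem_bounds sw erefl kv).
by rewrite leNgt kx in xk'.
Qed.

Lemma window_rcons (I : set int) (v : seq int) (y : int) :
  window I v -> v <> [::] -> I y -> last 0 v < y ->
  exists2 z : int, z <= y & window I (rcons v z).
Proof.
case: v => // x w [sw mw] _ Iy /(ex_least_above Iy)[z [/andP[xz zy] Iz nI]].
exists z => //; split=> [|k]; first by rewrite /= rcons_path; apply/andP.
rewrite rcons_cons -rcons_cons last_rcons => /andP[xk kz].
rewrite mem_rcons inE; have [->|nkz] := eqVneq k z; first by [].
have kltz : k < z by rewrite lt_neqAle nkz.
have [kl|lk] := leP k (last 0 (x :: w)).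
  by apply: mw; rewrite /= in xk *; rewrite xk.
split=> [kv|]; last by move=> /nI[]; apply/andP.
have [_] := andP (sorted_mem_bounds sw erefl kv).
by rewrite [(x :: w)`_(size w)](nth_last 0 (x :: w)) leNgt lk.
Qed.

Lemma window_grow_left (I : set int) (v : seq int) (c : int) (k : nat) :
  window I v -> v <> [::] -> c <= v`_0 ->
  (forall l : int, c - k%:Z <= l < c -> I l) ->
  exists u, [/\ size u = k, window I (u ++ v) & c - k%:Z <= (u ++ v)`_0].
Proof.
move=> wv nv cv; elim: k => [|k IH] fI; first by exists [::]; rewrite subr0.
have [|u [zu wu lu]] := IH; first by move=> l lb; apply: fI; lia.
have [||||z zl wz] := @window_cons I (u ++ v) (c - k.+1%:Z) => //.
- by case: u {zu wu lu}; case: (v) nv.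
- by apply: fI; lia.
- by lia.
- by exists (z :: u); split; rewrite /= ?zu.
Qed.

Lemma window_grow_right (I : set int) (v : seq int) (d : int) (k : nat) :
  window I v -> v <> [::] -> last 0 v <= d ->
  (forall l : int, d < l <= d + k%:Z -> I l) ->
  exists u, [/\ size u = k, window I (v ++ u) & last 0 (v ++ u) <= d + k%:Z].
Proof.
move=> wv nv cv; elim: k => [|k IH] fI; first by exists [::]; rewrite addr0 cats0.
have [|u [zu wu lu]] := IH; first by move=> l lb; apply: fI; lia.
have [||||z zl wz] := @window_rcons I (v ++ u) (d + k.+1%:Z) => //.
- by case: (v) nv.
- by apply: fI; lia.
- by lia.
- by exists (rcons u z); rewrite size_rcons zu -rcons_cat last_rcons.
Qed.

(** The conditions under which [I] has a local index vector around [a].  The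
frame lines provide [p./2] elements of [I] on either side of the active region;
the second part says that [a] can be the middle of such a vector. *)
Definition centered (p mu : nat) (I : set int) (a : factor) : Prop :=
  (forall l : int, in_frame_index p mu l -> I l) /\
  match a with
  | Pt i => [/\ ~~ odd p, 1 <= i <= mu%:Z & I i]
  | Itv i j => [/\ odd p, [/\ 1 <= i, i < j & j <= mu%:Z], I i, I j
      & forall k : int, i < k < j -> ~ I k]
  end.

Lemma centered_seed (p mu : nat) (I : set int) (a : factor) :
  centered p mu I a -> exists v, [/\ window I v, size v = (odd p).+1,
     1 <= v`_0, last 0 v <= mu%:Z & a = if odd p then Itv v`_0 v`_1 else Pt v`_0].
Proof.
case: a => [i|i j] [_].
- move=> [/negPf-> /andP[i1 imu] Ii]; exists [:: i]; split=> //; split=> //= k.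
  by move=> /le_anti <-; rewrite inE eqxx.
- move=> [-> [i1 ij jmu] Ii Ij nI]; exists [:: i; j]; split=> //; split=> /= [|k].
    by rewrite ij.
  move=> /andP[ik kj]; rewrite !inE; have [->|ki] := eqVneq k i; first by [].
  have [->|kj'] := eqVneq k j; first by [].
  by split=> // /nI[]; apply/andP; split; lia.
Qed.

(** Start from the end points of [a] and add [p./2] elements of [I] on each
side; the total is [p + 1] for both parities of [p]. *)
Lemma local_index_exists (p mu : nat) (I : set int) (a : factor) :
  centered p mu I a -> is_local_index p I a (local_index p I a).
Proof.
move=> ca; apply: xgetPex.
have [v [wv zv v1 vmu ->]] := centered_seed ca; case: ca => fI _.
have nv : v <> [::] by case: (v) zv.
have [|u [zu wu lu]] := window_grow_left (k := p./2) wv nv v1.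
  by move=> l lb; apply: fI; rewrite /in_frame_index /ilo; lia.
have [|||w [zw ww lw]] := window_grow_right (d := mu%:Z) (k := p./2) wu.
- by case: (u) => //; case: (v) nv.
- by rewrite last_cat; case: (v) nv vmu.
- by move=> l lb; apply: fI; rewrite /in_frame_index /ihi; lia.
exists ((u ++ v) ++ w).
have zz : size ((u ++ v) ++ w) = p.+1.
  by rewrite !size_cat zu zv zw; have := odd_double_half p; lia.
case: ww => sw mw; split=> //.
- by move=> k; rewrite -(nth_last 0) zz in mw *; apply: mw.
- rewrite -catA !nth_cat zu ltnn subnn zv /=; case: odd => //=.
  by rewrite ltnNge leqnSn /= subSnn.
Qed.

Lemma local_index_gap (p : nat) (I : set int) (a : factor) (v : seq int)
    (i : nat) (k : int) :
  is_local_index p I a v -> (i < p)%N -> v`_i < k < v`_i.+1 -> ~ I k.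
Proof.
move=> [zv sv mv _] ip /andP[ik ki] Ik.
have ilt : (i < size v)%N by rewrite zv leqW.
have Silt : (i.+1 < size v)%N by rewrite zv ltnS.
have [vi _] := andP (sorted_mem_bounds sv zv (mem_nth 0 ilt)).
have [_ vSi] := andP (sorted_mem_bounds sv zv (mem_nth 0 Silt)).
have /mv[_ /(_ Ik)/(nthP 0)[j jlt jk]] : v`_0 <= k <= v`_p.
  by rewrite (le_trans vi (ltW ik)) (le_trans (ltW ki) vSi).
move: ik ki; rewrite -jk !(lt_sorted_ltn_nth 0 sv) ?inE // ltnS => ij.
by rewrite leqNgt ij.
Qed.

(** Going down from the middle, the entry [k] places below it is at least
[1 - k]: otherwise the frame line [1 - k] would be an element of [I] strictly
between this entry and the next one.  Going up is symmetric. *)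
Lemma local_index_subset (p mu : nat) (I : set int) (a : factor) (v : seq int) :
  centered p mu I a -> is_local_index p I a v -> {subset v <= knot_indices p mu}.
Proof.
move=> [fI ca] lv; have [zv sv mv ea] := lv.
have pE := odd_double_half p.
have mid : 1 <= v`_(p./2) /\ v`_(p./2 + odd p) <= mu%:Z.
  move: ca; rewrite ea; case: odd; rewrite ?addn0 ?addn1.
    by move=> [_ []].
  by move=> [_ /andP[]].
have lo k : (k <= p./2)%N -> 1 - k%:Z <= v`_(p./2 - k).
  elim: k => [|k IH] kp; first by rewrite subn0 subr0; case: mid.
  have IHk := IH (ltnW kp); rewrite leNgt; apply/negP => lt.
  apply: (@local_index_gap _ _ _ _ (p./2 - k.+1) (- k%:Z) lv); first by lia.
    by apply/andP; rewrite subnSK //; lia.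
  by apply: fI; rewrite /in_frame_index /ilo; lia.
have hi k : (k <= p./2)%N -> v`_(p./2 + odd p + k) <= mu%:Z + k%:Z.
  elim: k => [|k IH] kp; first by rewrite addn0 addr0; case: mid.
  have IHk := IH (ltnW kp); rewrite leNgt; apply/negP => lt.
  apply: (@local_index_gap _ _ _ _ (p./2 + odd p + k) (mu%:Z + k.+1%:Z) lv).
  - by lia.
  - by apply/andP; rewrite -addnS; lia.
  - by apply: fI; rewrite /in_frame_index /ihi; lia.
move=> k /(sorted_mem_bounds sv zv)/andP[k0 kp].
have := lo _ (leqnn _); have := hi _ (leqnn _); rewrite subnn.
have -> : (p./2 + odd p + p./2)%N = p by lia.
move=> hp h0; apply/mapP; exists (absz (k - ilo p)%R).
  by rewrite mem_iota /ilo; lia.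
by rewrite /ilo; lia.
Qed.

(** * Transposition of a mesh *)

Definition swap (T U : Type) (x : T * U) : U * T := (x.2, x.1).

Lemma box_set_swap (R : realType) (A : box) (z : R * R) :
  box_set R (swap A) z <-> box_set R A (swap z).
Proof. by split=> -[]. Qed.

Lemma boundary_swap (R : realType) (A : box) (z : R * R) :
  boundary R (swap A) z <-> boundary R A (swap z).
Proof.
by split=> -[[cl1 cl2] nop]; split=> // -[op1 op2]; apply: nop.
Qed.

Lemma transpose_rectangle (R : realType) (p q mu nu : nat)
    (M : tmesh R p q mu nu) (C : box) :
  cells M (swap C) -> is_rectangle C.
Proof.
move=> /cells_rectangle[i1 [i2 [j1 [j2 [eC lti ltj]]]]].
by exists j1, j2, i1, i2; split=> //; case: C eC => a b [-> ->].
Qed.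

Lemma transpose_disjoint (R : realType) (p q mu nu : nat)
    (M : tmesh R p q mu nu) (C D : box) :
  cells M (swap C) -> cells M (swap D) -> C <> D ->
  box_set R C `&` box_set R D = set0.
Proof.
move=> MC MD CD; rewrite -subset0 => z [zC zD].
have sCD : swap C <> swap D.
  by case: C D CD {MC MD zC zD} => [a b] [c d] ne [ba bc]; apply: ne; rewrite ba bc.
have : (box_set R (swap C) `&` box_set R (swap D)) (swap z).
  by split; case: z zC zD => x y [? ?] [? ?].
by rewrite (cells_disjoint MC MD sCD).
Qed.

Lemma transpose_cover (R : realType) (p q mu nu : nat)
    (M : tmesh R p q mu nu) :
  \bigcup_(C in [set C | cells M (swap C)]) closed_box_set R C =
  index_domain R q p nu mu.
Proof.
apply/seteqP; split=> [[x y] [C MC [Cx Cy]]|[x y] [Dx Dy]].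
  have : index_domain R p q mu nu (y, x) by rewrite -(cells_cover M); exists (swap C).
  by case.
have : index_domain R p q mu nu (y, x) by [].
rewrite -(cells_cover M) => -[[a b] MC [Ca Cb]].
by exists (b, a).
Qed.

(** Exchanging the coordinates exchanges horizontal and vertical edges, so a
result on horizontal index vectors for all meshes gives the vertical one. *)
Definition transpose (R : realType) (p q mu nu : nat)
    (M : tmesh R p q mu nu) : tmesh R q p nu mu :=
  TMesh (@transpose_rectangle R p q mu nu M)
    (@transpose_disjoint R p q mu nu M) (transpose_cover M).

Lemma is_vertex_transpose (R : realType) (p q mu nu : nat)
    (M : tmesh R p q mu nu) (i j : int) :
  is_vertex (transpose M) j i <-> is_vertex M i j.
Proof.
by split=> -[i1 [i2 [j1 [j2 [MC hi hj]]]]]; exists j1, j2, i1, i2.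
Qed.

Lemma cell_boundaries_transpose (R : realType) (p q mu nu : nat)
    (M : tmesh R p q mu nu) (z : R * R) :
  cell_boundaries (transpose M) z <-> cell_boundaries M (swap z).
Proof.
case: z => x y; split=> -[[a b] MC bz]; exists (b, a) => //;
  exact/(boundary_swap (a, b)).
Qed.

Lemma hedges_transpose (R : realType) (p q mu nu : nat)
    (M : tmesh R p q mu nu) (A : box) :
  hedges (transpose M) A <-> vedges M (swap A).
Proof.
case: A => a b; split.
- move=> [i1 [i2 [j [[-> ->] [lt v1 v2 nv sub]]]]]; exists j, i1, i2; split=> //.
  split=> //; try exact/is_vertex_transpose.
    by move=> k kb /is_vertex_transpose; apply: nv.
  by move=> [x y] [xA yA]; apply/(cell_boundaries_transpose M (y, x))/sub.
- move=> [j [i1 [i2 [[-> ->] [lt v1 v2 nv sub]]]]]; exists i1, i2, j; split=> //.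
  split=> //; try exact/is_vertex_transpose.
    by move=> k kb /is_vertex_transpose; apply: nv.
  by move=> [x y] [xA yA]; apply/(cell_boundaries_transpose M (x, y))/sub.
Qed.

Lemma vedges_transpose (R : realType) (p q mu nu : nat)
    (M : tmesh R p q mu nu) (A : box) :
  vedges (transpose M) A <-> hedges M (swap A).
Proof.
case: A => a b; split.
- move=> [j [i1 [i2 [[-> ->] [lt v1 v2 nv sub]]]]]; exists i1, i2, j; split=> //.
  split=> //; try exact/is_vertex_transpose.
    by move=> k kb /is_vertex_transpose; apply: nv.
  by move=> [x y] [xA yA]; apply/(cell_boundaries_transpose M (y, x))/sub.
- move=> [i1 [i2 [j [[-> ->] [lt v1 v2 nv sub]]]]]; exists j, i1, i2; split=> //.
  split=> //; try exact/is_vertex_transpose.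
    by move=> k kb /is_vertex_transpose; apply: nv.
  by move=> [x y] [xA yA]; apply/(cell_boundaries_transpose M (x, y))/sub.
Qed.

Lemma vertices_transpose (R : realType) (p q mu nu : nat)
    (M : tmesh R p q mu nu) (A : box) :
  vertices (transpose M) A <-> vertices M (swap A).
Proof.
case: A => a b; split=> -[i [j [[-> ->] /is_vertex_transpose v]]];
  by exists j, i; split=> //; apply/is_vertex_transpose.
Qed.

Lemma vS_transpose (R : realType) (p q mu nu : nat)
    (M : tmesh R p q mu nu) (z : R * R) :
  vS (transpose M) z <-> hS M (swap z).
Proof.
split=> -[A [e|v] Az].
- by exists (swap A); [left; apply/vedges_transpose|apply/box_set_swap; case: z Az].
- by exists (swap A); [right; apply/vertices_transpose|apply/box_set_swap; case: z Az].
- exists (swap A); last exact/box_set_swap.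
  by left; apply/vedges_transpose; case: A e {Az}.
- exists (swap A); last exact/box_set_swap.
  by right; apply/vertices_transpose; case: A v {Az}.
Qed.

Lemma skeleton_transpose (R : realType) (p q mu nu : nat)
    (M : tmesh R p q mu nu) (z : R * R) :
  skeleton M (swap z) -> skeleton (transpose M) z.
Proof.
move=> [[a b] Ae Az]; exists (b, a); last by apply/(box_set_swap (a, b)).
case: Ae => [[h|v]|v].
- by left; right; apply/vedges_transpose.
- by left; left; apply/hedges_transpose.
- by right; apply/vertices_transpose.
Qed.

Lemma global_hindex_transpose (R : realType) (p q mu nu : nat)
    (M : tmesh R p q mu nu) (A : box) :
  global_hindex (transpose M) (swap A) = global_vindex M A.
Proof.
apply/seteqP; split=> i Ii [x y] [/= zx zy].
  by apply/(vS_transpose M (y, x))/Ii.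
by apply/vS_transpose/Ii.
Qed.

Lemma anchors_transpose (R : realType) (p q mu nu : nat)
    (M : tmesh R p q mu nu) (A : box) :
  anchors M A -> anchors (transpose M) (swap A).
Proof.
case: A => a b [AR hA]; split.
  by move=> [x y] [xa yb]; have [] := AR (y, x) (conj yb xa).
case: (odd p) hA; case: (odd q) => //.
- by move=> ?; apply/vedges_transpose.
- by move=> ?; apply/hedges_transpose.
- by move=> ?; apply/vertices_transpose.
Qed.

(** * Segments of the mesh that cross *)

(** Half-integers are used as test points because they differ from all integer
coordinates: a point half a step beyond an integer is inside every unit step
that starts there, and weak and strict comparisons with it agree. *)
Lemma ler_int_half (R : realType) (i j : int) :
  (i%:~R <= j%:~R + 2^-1 :> R) = (i <= j).
Proof.
have [ij|ji] := leP i j.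
  have h : i%:~R <= j%:~R :> R by rewrite ler_int.
  by apply/idP; lra.
have : (j + 1)%:~R <= i%:~R :> R by rewrite ler_int; lia.
rewrite intrD => h; apply/negbTE; rewrite -ltNge; lra.
Qed.

Lemma ltr_int_half (R : realType) (i j : int) :
  (i%:~R < j%:~R + 2^-1 :> R) = (i <= j).
Proof.
have [ij|ji] := leP i j.
  have h : i%:~R <= j%:~R :> R by rewrite ler_int.
  by apply/idP; lra.
have : (j + 1)%:~R <= i%:~R :> R by rewrite ler_int; lia.
rewrite intrD => h; apply/negbTE; rewrite -leNgt; lra.
Qed.

Lemma int_half_in_itv (R : realType) (i j : int) :
  i < j -> i%:~R < (i%:~R + 2^-1 : R) < j%:~R.
Proof.
move=> ij; have : (i + 1)%:~R <= j%:~R :> R by rewrite ler_int; lia.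
by rewrite intrD => h; apply/andP; split; lra.
Qed.

Lemma int_half_in_domain (R : realType) (p mu : nat) (k : int) :
  ilo p <= k -> k < ihi p mu -> domain_itv R p mu (k%:~R + 2^-1).
Proof.
move=> lo /(int_half_in_itv R)/andP[_ hi].
have : (ilo p)%:~R <= k%:~R :> R by rewrite ler_int.
by rewrite /domain_itv /= in_itv /= => ?; apply/andP; split; lra.
Qed.

Lemma itv_oo_cc_meet (R : realType) (i j k l : int) (x : R) :
  k < l -> i%:~R < x < j%:~R -> k%:~R <= x <= l%:~R ->
  exists y : R, i%:~R < y < j%:~R /\ k%:~R < y < l%:~R.
Proof.
move=> kl /andP[ix xj] /andP[kx xl].
have klR : k%:~R < l%:~R :> R by rewrite ltr_int.
pose a : R := Num.max i%:~R k%:~R; pose b : R := Num.min j%:~R l%:~R.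
have ab : a < b.
  by rewrite gt_max !lt_min; apply/andP; split; apply/andP; split; lra.
exists ((a + b) / 2).
have [a1 a2] : i%:~R <= a /\ k%:~R <= a by rewrite !le_max !lexx orbT.
have [b1 b2] : b <= j%:~R /\ b <= l%:~R by rewrite !ge_min !lexx orbT.
split; apply/andP; split; lra.
Qed.

(** If the boundary of a cell [D] met the open cell [C], the open cell [D]
would meet [C] as well: in each coordinate, a closed interval of positive length
that meets an open interval also meets it inside its own interior. *)
Lemma cell_boundaries_not_open (R : realType) (p q mu nu : nat)
    (M : tmesh R p q mu nu) (C : box) (z : R * R) :
  cells M C -> box_set R C z -> ~ cell_boundaries M z.
Proof.
move=> MC Cz [D MD [Dz nDz]].
have CD : C <> D by move=> CD; rewrite -CD in nDz.
have [i1 [i2 [j1 [j2 [eC lti ltj]]]]] := cells_rectangle MC.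
have [k1 [k2 [l1 [l2 [eD ltk ltl]]]]] := cells_rectangle MD.
move: Cz Dz; rewrite eC eD; case: z nDz => x y _ [/= + +] [/= + +].
rewrite !in_itv /= => Cx Cy Dx Dy.
have [x' [Cx' Dx']] := itv_oo_cc_meet ltk Cx Dx.
have [y' [Cy' Dy']] := itv_oo_cc_meet ltl Cy Dy.
have : (box_set R C `&` box_set R D) (x', y').
  by rewrite eC eD; split; split; rewrite /= in_itv.
by rewrite (cells_disjoint MC MD CD).
Qed.

(** The cell containing the point half a step up and right of [(i, j)] has
integer corners, so it reaches down to [j] and left to [i]; if it went further,
one of the two given boundary points would be in its interior. *)
Lemma crossing_is_vertex (R : realType) (p q mu nu : nat)
    (M : tmesh R p q mu nu) (i j : int) :
  index_domain R p q mu nu (i%:~R + 2^-1, j%:~R + 2^-1) ->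
  cell_boundaries M (i%:~R + 2^-1, j%:~R) ->
  cell_boundaries M (i%:~R, j%:~R + 2^-1) ->
  is_vertex M i j.
Proof.
rewrite -(cells_cover M) => -[C MC Cz] bh bv.
have [i1 [i2 [j1 [j2 [eC _ _]]]]] := cells_rectangle MC.
have nbh := fun h => cell_boundaries_not_open MC h bh.
have nbv := fun h => cell_boundaries_not_open MC h bv.
exists i1, i2, j1, j2.
move: MC Cz nbh nbv {bh bv}; rewrite eC => MC -[/=]; rewrite !in_itv /= !ler_int_half.
move=> /andP[i1i ii2] /andP[j1j jj2] nbh nbv.
have lt_of (k l : int) : k%:~R + 2^-1 <= l%:~R :> R -> k < l.
  by move=> h; rewrite -(ltr_int R); lra.
have {}ii2 := lt_of _ _ ii2; have {}jj2 := lt_of _ _ jj2.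
have [_ ii2h] := andP (int_half_in_itv R ii2).
have [_ jj2h] := andP (int_half_in_itv R jj2).
split=> //; left.
- apply/eqP; rewrite eq_le i1i andbT leNgt; apply/negP => lt.
  by apply: nbv; split; rewrite /= in_itv /= ?ltr_int ?lt ?ii2 ?ltr_int_half ?j1j ?jj2h.
- apply/eqP; rewrite eq_le j1j andbT leNgt; apply/negP => lt.
  by apply: nbh; split; rewrite /= in_itv /= ?ltr_int ?lt ?jj2 ?ltr_int_half ?i1i ?ii2h.
Qed.

Lemma is_vertex_boundary (R : realType) (p q mu nu : nat)
    (M : tmesh R p q mu nu) (i j : int) :
  is_vertex M i j -> cell_boundaries M (i%:~R, j%:~R).
Proof.
move=> [i1 [i2 [j1 [j2 [MC hi hj]]]]]; exists (Itv i1 i2, Itv j1 j2) => //.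
have [i1' [i2' [j1' [j2' [[<- <- <- <-] lti ltj]]]]] := cells_rectangle MC.
split; last first.
  by move=> [/=]; rewrite in_itv /= !ltr_int; case: hi => ->; rewrite ltxx ?andbF.
split; rewrite /= in_itv /= !ler_int.
  by case: hi => ->; rewrite lexx (ltW lti).
by case: hj => ->; rewrite lexx (ltW ltj).
Qed.

Lemma vS_boundary (R : realType) (p q mu nu : nat) (M : tmesh R p q mu nu) :
  vS M `<=` cell_boundaries M.
Proof.
move=> z [A [[i [j1 [j2 [-> [_ _ _ _ sub]]]]]|[i [j [-> v]]]]]; first exact: sub.
by case: z => x y [/= -> ->]; apply: is_vertex_boundary.
Qed.

Lemma skeleton_boundary (R : realType) (p q mu nu : nat) (M : tmesh R p q mu nu) :
  skeleton M `<=` cell_boundaries M.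
Proof.
move=> z [A [[h|v]|v] Az].
- by case: h Az => i1 [i2 [j [-> [_ _ _ _ sub]]]]; apply: sub.
- by apply: vS_boundary; exists A => //; left.
- by apply: vS_boundary; exists A => //; right.
Qed.

Lemma is_vertex_range (R : realType) (p q mu nu : nat)
    (M : tmesh R p q mu nu) (i j : int) :
  is_vertex M i j -> ilo p <= i <= ihi p mu.
Proof.
move=> /is_vertex_boundary[C MC [Cz _]].
have : index_domain R p q mu nu (i%:~R, j%:~R) by rewrite -(cells_cover M); exists C.
by move=> [/=]; rewrite /domain_itv /= in_itv /= !ler_int.
Qed.

(** * Global index vectors of anchors *)

Definition vertical_frame (R : realType) (p q mu nu : nat)
    (M : tmesh R p q mu nu) : Prop :=
  forall l : int, in_frame_index p mu l ->
    [set l%:~R] `*` domain_itv R q nu `<=` skeleton M.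

(** A frame line is only known to lie in the skeleton, so one of its points
might be covered by a horizontal edge alone.  Such a point has integer
coordinates, the line goes on above it and the edge to the right of it, so it
is a vertex.  As [q >= 2], the line still has points of the index domain above
the active region. *)
Lemma vertical_frame_vS (R : realType) (p q mu nu : nat)
    (M : tmesh R p q mu nu) (l : int) :
  (2 <= q)%N -> vertical_frame M -> in_frame_index p mu l ->
  [set l%:~R] `*` `[1, nu%:R] `<=` vS M.
Proof.
move=> hq fr fl [x y] [/= -> ]; rewrite in_itv /= => /andP[y1 ynu].
have q2 : (1 <= q./2)%N by rewrite -[1%N]/(2./2) half_leq.
have dom (u : R) : 1 <= u <= nu%:R + 2^-1 -> domain_itv R q nu u.
  move=> /andP[u1 unu]; rewrite /domain_itv /= in_itv /=.
  have h1 : (ilo q)%:~R <= 1 :> R by rewrite -[1]/(1%:~R) ler_int /ilo; lia.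
  have h2 : nu%:R + 1 <= (ihi q nu)%:~R :> R.
    by rewrite -[nu%:R]/(nu%:Z%:~R) -[1]/(1%:~R) -intrD ler_int /ihi; lia.
  by apply/andP; split; lra.
have half0 : 0 <= 2^-1 :> R by lra.
have : skeleton M (l%:~R, y).
  by apply: (fr l fl); split=> //; apply: dom; rewrite y1 (le_trans ynu) ?lerDl.
move=> [A [[h|v]|v] Az]; last 2 first.
- by exists A => //; left.
- by exists A => //; right.
case: h Az => i1 [i2 [j [-> [_ v1 v2 nv sub]]]] [/=].
rewrite in_itv /= !ltr_int => /andP[il li] yj.
have /andP[i1lo _] := is_vertex_range v1; have /andP[_ i2hi] := is_vertex_range v2.
exists (Pt l, Pt j); last by rewrite yj.
right; exists l, j; split=> //; apply: crossing_is_vertex.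
- split; last by apply: dom; rewrite -yj lerD2r ynu (le_trans y1) ?lerDl //.
  by apply: int_half_in_domain; [apply/ltW/(le_lt_trans i1lo)|apply: lt_le_trans i2hi].
- apply: sub; split=> //=; rewrite in_itv /= ltr_int_half (ltW il) /=.
  by have /andP[] := int_half_in_itv R li.
- apply/skeleton_boundary/(fr l fl); split=> //=; apply: dom.
  by rewrite -yj lerD2r ynu (le_trans y1) ?lerDl.
Qed.

Definition proper_factor (a : factor) : Prop :=
  match a with Pt _ => True | Itv i j => i < j end.

Definition in_range (mu : nat) (a : factor) : Prop :=
  match a with
  | Pt i => 1 <= i <= mu%:Z
  | Itv i j => [/\ 1 <= i, i < j & j <= mu%:Z]
  end.

Lemma proper_factor_nonempty (R : realType) (a : factor) :
  proper_factor a -> exists x, factor_set R a x.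
Proof.
case: a => [i _|i j /= ij]; first by exists i%:~R.
by exists (i%:~R + 2^-1); rewrite /= in_itv /= int_half_in_itv.
Qed.

Lemma proper_factor_in_range (R : realType) (mu : nat) (a : factor) :
  proper_factor a -> factor_set R a `<=` `[1, mu%:R] -> in_range mu a.
Proof.
have e1 : 1 = 1%:~R :> R by [].
have emu : mu%:R = mu%:Z%:~R :> R by [].
case: a => [i _ /(_ _ erefl)|i j /= ij sub].
  by rewrite /= in_itv /= e1 emu !ler_int.
split=> //.
  have := sub (i%:~R + 2^-1); rewrite /= !in_itv /= int_half_in_itv // e1 ler_int_half.
  by move=> /(_ isT)/andP[].
have jE : j%:~R = (j - 1)%:~R + 1 :> R by rewrite intrB subrK.
have ji : i%:~R <= (j - 1)%:~R :> R by rewrite ler_int; lia.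
have := sub (j%:~R - 2^-1); rewrite /= !in_itv /= => /(_ _)/andP[|_].
  by apply/andP; split; lra.
rewrite emu => h; have : j%:~R <= mu%:Z%:~R + 2^-1 :> R by lra.
by rewrite ler_int_half.
Qed.

Lemma anchor_proper_factor (R : realType) (p q mu nu : nat) (M : tmesh R p q mu nu)
    (A : box) : anchors M A -> proper_factor A.1 /\ proper_factor A.2.
Proof.
move=> [_]; case: odd; case: odd.
- by move=> /cells_rectangle[i1 [i2 [j1 [j2 [->]]]]].
- by move=> [i1 [i2 [j [-> []]]]].
- by move=> [i [j1 [j2 [-> []]]]].
- by move=> [i [j [->]]].
Qed.

Lemma anchor_active (R : realType) (p q mu nu : nat) (M : tmesh R p q mu nu)
    (A : box) : anchors M A ->
  factor_set R A.1 `<=` `[1, mu%:R] /\ factor_set R A.2 `<=` `[1, nu%:R].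
Proof.
move=> aA; have [/(proper_factor_nonempty R)[x xA] ] := anchor_proper_factor aA.
move=> /(proper_factor_nonempty R)[y yA].
case: aA => AR _.
by split=> u uA; [have [] := AR (u, y) (conj uA yA)|have [] := AR (x, u) (conj xA uA)].
Qed.

(** A vertical edge through an interior point of a horizontal edge would
cross it there, and produce a vertex inside that edge. *)
Lemma hedge_interior_not_vS (R : realType) (p q mu nu : nat)
    (M : tmesh R p q mu nu) (i1 i2 j k : int) :
  hedges M (Itv i1 i2, Pt j) -> i1 < k < i2 -> ~ vS M (k%:~R, j%:~R).
Proof.
move=> hA kb; case: (hA) => i1' [i2' [j' [[<- <- <-] [_ v1 v2 nv sub]]]].
move=> [A [v|v] Ak]; last first.
  case: v Ak => i' [j'' [-> vv]] [/= /eqP + /eqP]; rewrite !eqr_int => /eqP ek /eqP ej.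
  by apply: (nv k kb); rewrite ek ej.
case: v Ak => i' [j1 [j2 [-> [lt v1' v2' _ sub']]]] [/= /eqP].
rewrite eqr_int => /eqP ek; rewrite in_itv /= !ltr_int => jb.
apply: (nv k kb); apply: crossing_is_vertex.
- have /andP[lo1 _] := is_vertex_range v1; have /andP[_ hi2] := is_vertex_range v2.
  have /andP[lo1' _] := is_vertex_range ((is_vertex_transpose _ _ _).2 v1').
  have /andP[_ hi2'] := is_vertex_range ((is_vertex_transpose _ _ _).2 v2').
  have /andP[ik ki] := kb; have /andP[ij ji] := jb.
  split; apply: int_half_in_domain.
  + exact/ltW/(le_lt_trans lo1).
  + exact: lt_le_trans hi2.
  + exact/ltW/(le_lt_trans lo1').
  + exact: lt_le_trans hi2'.
- have /andP[ik ki] := kb; have /andP[_ kh] := int_half_in_itv R ki.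
  by apply: sub; split=> //=; rewrite in_itv /= kh ltr_int_half ltW.
- have /andP[ij ji] := jb; have /andP[_ jh] := int_half_in_itv R ji.
  by apply: sub'; split; rewrite /= ?ek // in_itv /= jh ltr_int_half ltW.
Qed.

(** The side of a cell may carry vertices of neighbouring cells.  A point
that is not a vertex lies between the nearest vertices below and above it,
which exist because the corners are vertices, and these bound a vertical
edge. *)
Lemma cell_side_vS (R : realType) (p q mu nu : nat)
    (M : tmesh R p q mu nu) (i1 i2 j1 j2 i : int) :
  cells M (Itv i1 i2, Itv j1 j2) -> i = i1 \/ i = i2 ->
  [set i%:~R] `*` `]j1%:~R, j2%:~R[ `<=` vS M.
Proof.
move=> MC hi [x y] [/= ->]; rewrite in_itv /= => /andP[j1y yj2].
have [[k kv ky]|nv] := pselect (exists2 k : int, is_vertex M i k & y = k%:~R).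
  by exists (Pt i, Pt k) => //; right; exists i, k.
have corner j : j = j1 \/ j = j2 -> is_vertex M i j by exists i1, i2, j1, j2.
have [||k1 [/andP[jk1 k1y] v1 n1]] :=
  @ex_greatest_below [set j | is_vertex M i j] (Num.ceil y) j1.
- by apply: corner; left.
- by rewrite ceil_gt_int.
have [||k2 [/andP[yk2 k2j] v2 n2]] :=
  @ex_least_above [set j | is_vertex M i j] (Num.floor y) j2.
- by apply: corner; right.
- by rewrite floor_lt_int.
have {}k1y : k1%:~R < y by rewrite -ceil_gt_int.
have {}yk2 : y < k2%:~R by rewrite -floor_lt_int.
exists (Pt i, Itv k1 k2); last by split; rewrite //= in_itv /= k1y.
left; exists i, k1, k2; split=> //; split=> //.
- by rewrite -(ltr_int R) (lt_trans k1y).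
- move=> k /andP[kk1 kk2] kv; apply: nv; exists k => //.
  apply/le_anti/andP; split.
    rewrite leNgt -ceil_gt_int; apply/negP => ky.
    by apply: (n1 k) kv; rewrite kk1.
  rewrite leNgt -floor_lt_int; apply/negP => yk.
  by apply: (n2 k) kv; rewrite yk.
- move=> [u w] [/= ->]; rewrite in_itv /= => /andP[k1w wk2].
  exists (Itv i1 i2, Itv j1 j2) => //.
  have [i1' [i2' [j1' [j2' [[<- <- _ _] lti _]]]]] := cells_rectangle MC.
  have jk1R : j1%:~R <= k1%:~R :> R by rewrite ler_int.
  have k2jR : k2%:~R <= j2%:~R :> R by rewrite ler_int.
  split; last first.
    by move=> [/=]; rewrite in_itv /= !ltr_int; case: hi => ->; rewrite ltxx ?andbF.
  split; rewrite /= in_itv /= ?ler_int; last by apply/andP; split; lra.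
  by case: hi => ->; rewrite lexx (ltW lti).
Qed.

(** When [A.1] is a point, the anchor is itself a vertex or a vertical edge on
this line.  When [A.1] is an interval, its ends carry the two end vertices of a
horizontal edge or the two vertical sides of a cell; no line of the global
index vector passes between them, as it would cut the edge in a vertex, or the
open cell. *)
Lemma anchor_hcentered (R : realType) (p q mu nu : nat)
    (M : tmesh R p q mu nu) (A : box) :
  (2 <= q)%N -> vertical_frame M -> anchors M A ->
  centered p mu (global_hindex M A) A.1.
Proof.
move=> hq fr aA; have [aA1 aA2] := anchor_active aA.
have [pA1 pA2] := anchor_proper_factor aA.
have r1 := proper_factor_in_range pA1 aA1.
split=> [l fl|].
  by move=> [x y] [xl /aA2 yb]; apply: (vertical_frame_vS hq fr fl); split.
case: aA r1 => _; case: ifP => op; case: ifP => oq.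
- move=> MA; have [i1 [i2 [j1 [j2 [eA lti ltj]]]]] := cells_rectangle MA.
  rewrite eA in MA * => r1; split=> //=.
  + by apply: cell_side_vS MA _; left.
  + by apply: cell_side_vS MA _; right.
  + move=> k kb Ik.
    have hj := int_half_in_itv R ltj.
    apply: (@cell_boundaries_not_open _ _ _ _ _ M _ (k%:~R, j1%:~R + 2^-1) MA).
      by split; rewrite /= in_itv /= ?ltr_int.
    by apply/vS_boundary/Ik; split; rewrite /= ?in_itv.
- move=> hA; have [i1 [i2 [j [eA [lt v1 v2 nv sub]]]]] := hA.
  rewrite eA in hA * => r1; split=> //=.
  + by move=> [x y] [/= -> ->]; exists (Pt i1, Pt j) => //; right; exists i1, j.
  + by move=> [x y] [/= -> ->]; exists (Pt i2, Pt j) => //; right; exists i2, j.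
  + by move=> k kb /(_ (k%:~R, j%:~R)) /(_ _)/(hedge_interior_not_vS hA kb); apply.
- move=> vA; have [i [j1 [j2 [eA _]]]] := vA.
  rewrite eA in vA * => r1; split=> //=.
  by move=> z zA; exists (Pt i, Itv j1 j2) => //; left.
- move=> vA; have [i [j [eA _]]] := vA.
  rewrite eA in vA * => r1; split=> //=.
  by move=> z zA; exists (Pt i, Pt j) => //; right.
Qed.

Lemma anchor_vcentered (R : realType) (p q mu nu : nat)
    (M : tmesh R p q mu nu) (A : box) :
  (2 <= p)%N ->
  (forall l : int, in_frame_index q nu l ->
     domain_itv R p mu `*` [set l%:~R] `<=` skeleton M) ->
  anchors M A -> centered q nu (global_vindex M A) A.2.
Proof.
move=> hp fr /anchors_transpose aA.
rewrite -global_hindex_transpose; apply: (anchor_hcentered hp _ aA).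
by move=> l fl [x y] [/= xl yd]; apply/skeleton_transpose/(fr l fl).
Qed.

(** * Shifts of anchors *)

Lemma same_index_overlap (p : nat) (I : set int) (a1 a2 : factor)
    (v1 v2 : seq int) :
  is_local_index p I a1 v1 -> is_local_index p I a2 v2 -> index_overlap p v1 v2.
Proof.
move=> [z1 s1 m1 _] [z2 s2 m2 _]; split=> k kv kb.
  by apply/(m2 k kb)/m1 => //; apply: sorted_mem_bounds s1 z1 kv.
by apply/(m1 k kb)/m2 => //; apply: sorted_mem_bounds s2 z2 kv.
Qed.

Lemma is_local_index_factor (p : nat) (I1 I2 : set int) (a1 a2 : factor)
    (v : seq int) :
  is_local_index p I1 a1 v -> is_local_index p I2 a2 v -> a1 = a2.
Proof. by move=> [_ _ _ ->] [_ _ _ ->]. Qed.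

Lemma overlap_local_shifted (R : realType) (p mu : nat) (s : int -> R)
    (I1 I2 : set int) (a1 a2 : factor) :
  knot_vector p mu s -> centered p mu I1 a1 -> centered p mu I2 a2 ->
  index_overlap p (local_index p I1 a1) (local_index p I2 a2) -> a1 <> a2 ->
  min_shifted s (local_index p I1 a1) (local_index p I2 a2) /\
  max_shifted s (local_index p I1 a1) (local_index p I2 a2).
Proof.
move=> ks c1 c2 o ne.
have l1 := local_index_exists c1; have l2 := local_index_exists c2.
have sub1 := local_index_subset c1 l1; have sub2 := local_index_subset c2 l2.
have [z1 s1 _ _] := l1; have [z2 s2 _ _] := l2.
apply: (overlap_shifted ks s1 z1 sub1 s2 z2 sub2 o) => e.
by apply: ne; rewrite -e in l2; apply: is_local_index_factor l1 l2.
Qed.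

(** Anchors with a common factor overlap in the other direction because they
have the same global index vector there; dual-compatibility is called upon
when both factors differ. *)
Lemma anchors_shifted (R : realType) (p q mu nu : nat)
    (M : tmesh R p q mu nu) (s t : int -> R) (A1 A2 : box) :
  (2 <= p)%N -> (2 <= q)%N -> knot_vector p mu s -> knot_vector q nu t ->
  admissible M -> dual_compatible M -> anchors M A1 -> anchors M A2 ->
  A1 <> A2 ->
  (left_shifted M s A1 A2 /\ right_shifted M s A1 A2) \/
  (down_shifted M t A1 A2 /\ up_shifted M t A1 A2).
Proof.
move=> hp hq hs ht [frv frh _] dc aA1 aA2 ne.
have frv' : vertical_frame M by move=> l fl z zl; have [] := frv l fl z zl.
have frh' (l : int) : in_frame_index q nu l ->
    domain_itv R p mu `*` [set l%:~R] `<=` skeleton M.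
  by move=> fl z zl; have [] := frh l fl z zl.
have h1 := anchor_hcentered hq frv' aA1; have h2 := anchor_hcentered hq frv' aA2.
have v1 := anchor_vcentered hp frh' aA1; have v2 := anchor_vcentered hp frh' aA2.
have hshift : overlap_horizontally M A1 A2 -> A1.1 <> A2.1 ->
    left_shifted M s A1 A2 /\ right_shifted M s A1 A2.
  exact: overlap_local_shifted hs h1 h2.
have vshift : overlap_vertically M A1 A2 -> A1.2 <> A2.2 ->
    down_shifted M t A1 A2 /\ up_shifted M t A1 A2.
  exact: overlap_local_shifted ht v1 v2.
have ne2 : A1.1 = A2.1 -> A1.2 <> A2.2.
  by case: A1 A2 ne {aA1 aA2 h1 h2 v1 v2 hshift vshift} => [a b] [c d] ne /= ac bd;
    apply: ne; rewrite ac bd.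
have [e1|n1] := pselect (A1.1 = A2.1).
  right; apply: vshift (ne2 e1).
  have eI : global_vindex M A1 = global_vindex M A2 by rewrite /global_vindex e1.
  have l1 := local_index_exists v1; have l2 := local_index_exists v2.
  by rewrite -eI in l2; rewrite /overlap_vertically /local_vindex -eI;
    apply: same_index_overlap l1 l2.
have [e2|n2] := pselect (A1.2 = A2.2).
  left; apply: hshift n1.
  have eI : global_hindex M A1 = global_hindex M A2 by rewrite /global_hindex e2.
  have l1 := local_index_exists h1; have l2 := local_index_exists h2.
  by rewrite -eI in l2; rewrite /overlap_horizontally /local_hindex -eI;
    apply: same_index_overlap l1 l2.
by have [oh|ov] := dc _ _ aA1 aA2; [left; apply: hshift|right; apply: vshift].
Qed.

Theorem theorem4p20 (R : realType) (p q mu nu : nat)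
    (M : tmesh R p q mu nu) (s t : int -> R)
    (hp : (2 <= p)%N) (hq : (2 <= q)%N) (hmu : (0 < mu)%N) (hnu : (0 < nu)%N)
    (hs : knot_vector p mu s) (ht : knot_vector q nu t)
    (hM : admissible_plus M) (hdc : dual_compatible M) :
  [/\ weakly_dual_compatible_RD M s t,
      weakly_dual_compatible_RU M s t,
      weakly_dual_compatible_LD M s t
    & weakly_dual_compatible_LU M s t].
Proof.
have [ad _ _] := hM.
by split=> A1 A2 aA1 aA2 ne;
  have [[l r]|[d u]] := anchors_shifted hp hq hs ht ad hdc aA1 aA2 ne;
  by [left|right].
Qed.
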